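(* Let $T$ and $T'$ be finite trees. Let $u,v\in V(T)$ and $u',v'\in V(T')$ be such that (1) $u$ is a vertex of degree 1 in a brush of $T$ with root $v$; (2) $u'$ is a vertex of degree 1 in a brush of $T'$ with root $v'$; (3) $T-u\cong T'-u'$ and $T-v\cong T'-v'$. Then $T$ and $T'$ are isomorphic.
   Context: All graphs are finite and simple. For a graph $G$ and a vertex $x$, $G-x$ denotes the graph obtained by deleting $x$ and all edges incident to it; $\cong$ denotes graph isomorphism. Let $T$ be a tree on at least 3 vertices. A brush in $T$ is a maximal subgraph $H$ of $T$ that is isomorphic to $K_{1,k}$ for some $k$, such that the $k$ leaves of $H$ (the vertices of $H$ other than its centre) have degree 1 in $T$, the remaining vertex $v$ of $H$ (the centre of the star), called the root of the brush, has degree at least $k+1$ in $T$, and $v$ is adjacent to at most one vertex not in $H$. *)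

(* Defs.v *)
From HB Require Import structures.
From mathcomp Require Import all_boot.

Set Implicit Arguments.
Unset Strict Implicit.
Unset Printing Implicit Defensive.

Record sgraph := SGraph {
  vertex :> finType;
  adj : rel vertex;
  adj_sym : symmetric adj;
  adj_irr : irreflexive adj
}.

Definition degree (G : sgraph) (x : G) : nat := #|[set y | adj x y]|.

Definition is_iso (G H : sgraph) (f : G -> H) : Prop :=
  bijective f /\ forall x y, adj (f x) (f y) = adj x y.

Definition isomorphic (G H : sgraph) : Prop := exists f : G -> H, is_iso f.

Definition is_connected (G : sgraph) : Prop :=
  0 < #|G| /\ forall x y : G, connect (@adj G) x y.

(* [ucycle] also holds of [:: x; y] for adjacent x and y, whence the bound. *)
Definition acyclic (G : sgraph) : Prop :=
  forall c : seq G, ucycle (@adj G) c -> size c <= 2.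

Definition is_tree (G : sgraph) : Prop := is_connected G /\ acyclic G.

Section Delete.
Variables (G : sgraph) (x : G).

Definition delete_adj : rel {y : G | y != x} := fun a b => adj (val a) (val b).

Lemma delete_adj_sym : symmetric delete_adj.
Proof. by move=> a b; apply: adj_sym. Qed.

Lemma delete_adj_irr : irreflexive delete_adj.
Proof. by move=> a; apply: adj_irr. Qed.

Definition delete_vertex : sgraph := SGraph delete_adj_sym delete_adj_irr.
End Delete.

Section Star.
Variable k : nat.

(* K_{1,k}: the centre is [None], the k leaves are the [Some i]. *)
Definition star_adj : rel (option 'I_k) := fun a b => isSome a != isSome b.

Lemma star_adj_sym : symmetric star_adj.
Proof. by move=> a b; rewrite /star_adj eq_sym. Qed.

Lemma star_adj_irr : irreflexive star_adj.
Proof. by move=> a; rewrite /star_adj eqxx. Qed.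

Definition star : sgraph := SGraph star_adj_sym star_adj_irr.
End Star.

Definition star_centre (k : nat) : star k := None.
Definition star_leaf (k : nat) (i : 'I_k) : star k := Some i.

(* Subgraphs are not assumed to be induced. *)
Record subgraph (G : sgraph) := Subgraph {
  sg_verts : {set G};
  sg_adj : rel G;
  sg_adj_sym : symmetric sg_adj;
  sg_adj_sub : forall x y,
    sg_adj x y -> [&& x \in sg_verts, y \in sg_verts & adj x y]
}.

Definition subgraph_le (G : sgraph) (H K : subgraph G) : Prop :=
  sg_verts H \subset sg_verts K /\ subrel (sg_adj H) (sg_adj K).

Section GraphOfSubgraph.
Variables (G : sgraph) (H : subgraph G).

Definition gos_adj : rel {x : G | x \in sg_verts H} :=
  fun a b => sg_adj H (val a) (val b).

Lemma gos_adj_sym : symmetric gos_adj.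
Proof. by move=> a b; apply: sg_adj_sym. Qed.

Lemma gos_adj_irr : irreflexive gos_adj.
Proof.
by move=> a; apply/negP => /sg_adj_sub /and3P[_ _]; rewrite adj_irr.
Qed.

Definition graph_of_subgraph : sgraph := SGraph gos_adj_sym gos_adj_irr.
End GraphOfSubgraph.

(* [f] singles out the centre, which the subgraph alone does not when k = 1.
   K_{1,0} is excluded: otherwise an end vertex lying in no larger brush would
   be a brush on its own, being at once its root and a vertex of degree 1. *)
Definition is_prebrush (G : sgraph) (H : subgraph G) (v : G) : Prop :=
  exists k : nat, 0 < k /\
  exists f : star k -> graph_of_subgraph H,
    [/\ is_iso f,
        val (f (star_centre k)) = v,
        forall i : 'I_k, degree (val (f (star_leaf i))) = 1,
        k + 1 <= degree v
      & #|[set w | adj v w & w \notin sg_verts H]| <= 1].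

Definition is_brush (G : sgraph) (H : subgraph G) (v : G) : Prop :=
  is_prebrush H v /\
  forall (K : subgraph G) (w : G),
    is_prebrush K w -> subgraph_le H K -> subgraph_le K H.

(* Degree 1 refers to the ambient graph: in a brush K_{1,1} the root also has
   degree 1 within the brush. *)
Definition end_of_brush_rooted_at (G : sgraph) (u v : G) : Prop :=
  exists H : subgraph G, [/\ is_brush H v, u \in sg_verts H & degree u = 1].

(* Main.v *)
Require Import Defs.
From mathcomp Require Import all_boot all_fingroup zify.
(* In T the root v has, besides the leaves of the brush, exactly one neighbour
   w; let S be T without the brush. Deleting v leaves S and isolated vertices,
   so S is isomorphic to S', and it remains to find an isomorphism from S to S'
   that maps w to w'. Deleting u leaves S with a smaller brush attached at w,
   so the tree R = T - u contains two brushes B1 and B2 of the same size, attached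
   at w1 and w2, such that R - B1 and R - B2 are isomorphic. If B1 and B2 are
   disjoint, then R - B1 is M = R - B1 - B2 with a brush attached at w2 and R - B2
   is M with a brush attached at w1, and by induction an automorphism of M maps w2
   to w1. In a forest, such an automorphism can be chosen to exchange the two
   vertices: it then extends to an isomorphism from R - B1 to R - B2 that maps
   w1 to w2. *)

Set Implicit Arguments.
Unset Strict Implicit.
Unset Printing Implicit Defensive.

(** * Exchanging two similar vertices of a forest *)

Section ForestSwap.
Variables (V : finType) (e : rel V).
Hypothesis e_sym : symmetric e.
Hypothesis e_acyclic : forall c : seq V, ucycle e c -> size c <= 2.

Definition avoid (a : V) : rel V := [rel s t | [&& e s t, s != a & t != a]].

(** For [x != a] this is the component of [x] once [a] is deleted; forbidding the edges at [a]
    avoids a subtype. *)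
Definition branch (a x : V) : {set V} := [set z | connect (avoid a) x z].

Lemma avoid_sym a : symmetric (avoid a).
Proof. by move=> s t; rewrite /avoid /= e_sym [(s != a) && _]andbC. Qed.

Lemma branch_root a x : x \in branch a x.
Proof. by rewrite inE. Qed.

Lemma branch_step a x z t :
  z \in branch a x -> z != a -> e z t -> t != a -> t \in branch a x.
Proof.
rewrite !inE => xz za zt ta; apply: connect_trans xz _.
by apply: connect1; rewrite /avoid /= zt za.
Qed.

Lemma branch_ind (P : pred V) a x :
    P x ->
    (forall s t, s \in branch a x -> P s -> e s t -> s != a -> t != a -> P t) ->
  {in branch a x, forall z, P z}.
Proof.
move=> Px Pstep z; rewrite inE => /connectP[p]; elim/last_ind: p z => [|p y IH] z.
  by move=> _ ->.
rewrite rcons_path last_rcons => /andP[xp /and3P[st sa ta]] ->.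
apply: Pstep st sa ta; last exact: IH xp _.
by rewrite inE; apply/connectP; exists p.
Qed.

Lemma branch_avoid a x : x != a -> a \notin branch a x.
Proof.
move=> xa; apply/negP => ax.
by have /eqP := @branch_ind (fun z => z != a) a x xa (fun s t _ _ _ _ ta => ta) a ax.
Qed.

Lemma path_avoid a x p : path e x p -> a \notin x :: p -> path (avoid a) x p.
Proof.
elim: p x => //= y p IH x /andP[xy yp]; rewrite !inE !negb_or /avoid /= => /and3P[xa ya ap].
by rewrite xy [x == a]eq_sym xa [y == a]eq_sym ya IH // inE negb_or ya.
Qed.

Lemma path_branch a x p :
  path e x p -> a \notin x :: p -> last x p \in branch a x.
Proof.
by move=> xp ap; rewrite inE; apply/connectP; exists p => //; apply: path_avoid.
Qed.

(** Otherwise a simple path from [x] to [y] off [a] would close up through [a] into a cycle on at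
    least three vertices. *)
Lemma branch_nbr_eq a x y : e a x -> e a y -> x != a -> y \in branch a x -> y = x.
Proof.
move=> ax ay xa; rewrite inE => /connectP[p0 xp0 ylast].
case/shortenP: xp0 ylast => p xp up _ ylast.
have ap : a \notin x :: p.
  apply/negP; rewrite inE eq_sym (negPf xa) /= => ap.
  case/splitPr: ap xp {up ylast} => p1 p2.
  by rewrite cat_path /avoid /= eqxx !andbF.
have /e_acyclic /= : ucycle e [:: a, x & p].
  apply/andP; split; last by rewrite cons_uniq ap.
  rewrite /= ax rcons_path -ylast e_sym ay andbT.
  by apply: sub_path xp => s t /and3P[].
by rewrite !ltnS leqn0 => /nilP pE; rewrite ylast pE.
Qed.

(** A walk from [b] off [a] can enter [branch b a] only from [b], hence at a neighbour of [b], which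
    by [branch_nbr_eq] is [a] itself. *)
Lemma branch_disjoint a b : e a b -> a != b -> [disjoint branch a b & branch b a].
Proof.
move=> ab neq_ab; rewrite disjoint_subset; apply/subsetP.
apply: branch_ind => [|s t _ sN st sa ta].
  by rewrite inE; apply: branch_avoid.
rewrite inE in sN *; apply: contra sN => tb.
have [sb|sb] := eqVneq s b.
  have tE : t = a by apply: branch_nbr_eq tb; rewrite // ?(e_sym b a) // -sb.
  by rewrite tE eqxx in ta.
have ntb : t != b by apply: contraTneq tb => ->; apply: branch_avoid.
by apply: branch_step tb ntb _ sb; rewrite e_sym.
Qed.

(** * Automorphisms of a forest and the pieces they exchange *)

Section Automorphism.
Variable g : {perm V}.
Hypothesis g_adj : forall x y, e (g x) (g y) = e x y.

Lemma mem_branch_perm a x z : (g z \in branch (g a) (g x)) = (z \in branch a x).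
Proof.
apply/idP/idP.
  rewrite -{2}(permK g z); move: (g z) => {}z; move: z.
  apply: (branch_ind (P := fun t => (g^-1)%g t \in branch a x)).
    by rewrite permK branch_root.
  move=> s t _ sP st sa ta; apply: branch_step sP _ _ _.
  - by rewrite -(inj_eq (@perm_inj _ g)) permKV.
  - by rewrite -g_adj !permKV.
  - by rewrite -(inj_eq (@perm_inj _ g)) permKV.
move: z; apply: (branch_ind (P := fun t => g t \in branch (g a) (g x))) => [|s t _ sP st sa ta].
  exact: branch_root.
by apply: branch_step sP _ _ _; rewrite ?(inj_eq perm_inj) ?g_adj.
Qed.

Lemma imset_branch a x : g @: branch a x = branch (g a) (g x).
Proof.
apply/setP => z; apply/imsetP/idP => [[t tP ->]|zP].
  by rewrite mem_branch_perm.
by exists ((g^-1)%g z); rewrite ?permKV // -mem_branch_perm permKV.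
Qed.

(* Otherwise g would act as a translation along the path, mapping the branch
   [branch a x] properly into itself. *)
Lemma perm_path_reverse a x p :
    path e a (x :: p) -> uniq (a :: x :: p) -> last x p = g a ->
  g x = last a (belast x p).
Proof.
move=> ap up gab; set y := last a _; set b := g a in gab.
have eax : e a x by case/andP: ap.
have xa : x != a by apply: contraTneq up => ->; rewrite /= mem_head.
have [ap' eyb] : path e a (belast x p) /\ e y b.
  by apply/andP; move: ap; rewrite lastI rcons_path gab.
have bNp : b \notin a :: belast x p.
  by move: up; rewrite lastI rcons_uniq [last _ _]gab => /andP[].
have yb : y != b by apply: contraNneq bNp => <-; rewrite /y mem_last.
have bD : b \in branch a x.
  by rewrite -gab; apply: path_branch; [case/andP: ap | case/andP: up].
have aD : a \in branch b y.
  rewrite inE (sym_connect_sym (avoid_sym b)); apply/connectP.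
  by exists (belast x p) => //; apply: path_avoid.
have egx : e b (g x) by rewrite g_adj.
have gxb : g x != b by rewrite (inj_eq perm_inj).
have gD : g @: branch a x = branch b (g x) by rewrite imset_branch.
apply/eqP/contraT => gxy.
(* Since [a] lies in [branch b y], it would otherwise join the distinct neighbours [y] and [g x] of
   [b] in one branch. *)
have aND : a \notin branch b (g x).
  apply: contra gxy => aD'; apply/eqP/(branch_nbr_eq _ egx yb).
    by rewrite e_sym.
  rewrite !inE in aD aD' *; apply: connect_trans aD _.
  by rewrite (sym_connect_sym (avoid_sym b)).
have sub : branch b (g x) \subset branch a x :\ b.
  apply/subsetP => z zD; rewrite in_setD1.
  rewrite (contraTneq _ zD) => [/=|->]; last exact: branch_avoid.
  move: z zD; apply: branch_ind => [|s t sD sP st sb tb].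
    apply: branch_step bD _ egx _.
      by apply: contraNneq bNp => ->; rewrite mem_head.
    by apply: contraNneq aND => <-; apply: branch_root.
  have tD : t \in branch b (g x) by apply: branch_step st tb.
  apply: branch_step sP _ st _.
    by apply: contraNneq aND => <-.
  by apply: contraNneq aND => <-.
(* [g] preserves cardinality, yet the image of [branch a x] lies in it and misses its element
   [b]. *)
have := subset_leq_card sub; rewrite -gD card_imset; last exact: perm_inj.
by rewrite [X in X <= _](cardsD1 b) bD ltnn.
Qed.

(* Exactly what is needed for the involution that is g on A, g^-1 on g(A) and the
   identity elsewhere to be an automorphism. *)
Definition swappable (A : {set V}) : Prop :=
  [disjoint A & g @: A] /\
  {in A, forall z w, w \notin A -> e z w -> g w = w \/ (w = g z /\ g w = z)}.

(** By [perm_path_reverse], peeling off both ends of the path leaves a path from [x] to [g x]. The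
    induction ends at an edge flipped by [g], where [A] is one side of that edge, or at a fixed
    midpoint, where [A] is a branch at that point. *)
Lemma swappable_path a x p :
    path e a (x :: p) -> uniq (a :: x :: p) -> last x p = g a ->
  exists2 A : {set V}, a \in A & swappable A.
Proof.
have [n] := ubnP (size p); elim: n a x p => // n IH a x p sp ap up gab.
have gxE := perm_path_reverse ap up gab.
have eax : e a x by case/andP: ap.
have ax : a != x by apply: contraTneq up => ->; rewrite /= mem_head.
case/lastP: p => [|q b'] in sp ap up gab gxE *.
  exists (branch x a); first exact: branch_root.
  rewrite /= in gab gxE; split.
    by rewrite imset_branch gxE -gab; apply: branch_disjoint; rewrite 1?e_sym 1?eq_sym.
  move=> z zA w wN zw; right.
  have zx : z != x by apply: contraTneq zA => ->; apply: branch_avoid.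
  have wx : w = x by apply/eqP; apply: contraNT wN => wx; apply: branch_step zA zx zw wx.
  have -> : z = a by apply: branch_nbr_eq zA; rewrite // e_sym // -wx.
  by rewrite wx -gab gxE.
rewrite belast_rcons /= last_rcons in gab gxE.
case: q => [|x2 q] in sp ap up gab gxE *; last first.
  have {}sp : size q < n by move: sp; rewrite size_rcons /= ltnS => /ltnW.
  have [||A xA swA] := IH x x2 q sp _ _ (esym gxE).
  - by move: ap; rewrite -rcons_cons rcons_path => /andP[/andP[]].
  - by move: up; rewrite cons_uniq -rcons_cons rcons_uniq => /and3P[].
  (* If [a] were outside [A], the edge from [x] to [a] would force [g a = a] or [g a = x], and the
     path would repeat a vertex. *)
  exists A => //; apply: contraT => aN.
  case: swA => _ /(_ x xA a aN); rewrite e_sym eax => /(_ isT)[gaa|[_ gax]].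
    by move: up; rewrite gab gaa /= !(inE, mem_rcons) eqxx !orbT.
  by move: up; rewrite gab gax /= !(inE, mem_rcons) eqxx !orbT andbF.
exists (branch x a); first exact: branch_root.
rewrite /= in gxE.
have bx : g a != x by rewrite -gxE (inj_eq perm_inj).
have exb : e x (g a) by rewrite -[in X in e X _]gxE g_adj e_sym.
split.
  rewrite imset_branch gxE disjoint_subset; apply/subsetP => z zA.
  rewrite inE; apply/negP => zB.
  have /eqP : g a = a.
    apply: (branch_nbr_eq _ exb ax); first by rewrite e_sym.
    rewrite !inE in zA zB *; apply: connect_trans zA _.
    by rewrite (sym_connect_sym (avoid_sym x)).
  by apply/negP; apply: contraTneq up => gaa; rewrite gab gaa /= !inE eqxx orbT.
move=> z zA w wN zw; left.
have zx : z != x by apply: contraTneq zA => ->; apply: branch_avoid.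
suff -> : w = x by [].
by apply/eqP; apply: contraNT wN => wx; apply: branch_step zA zx zw wx.
Qed.

Lemma swappable_exists a : g a != a -> exists2 A : {set V}, a \in A & swappable A.
Proof.
move=> gaa; have [/connectP[p0 ap0 lp0]|Nc] := boolP (connect e a (g a)).
  case/shortenP: ap0 lp0 => [[|x p]] ap up _ lp.
    by rewrite lp eqxx in gaa.
  exact: swappable_path ap up (esym lp).
have csym := sym_connect_sym e_sym.
(* The whole component of [a] serves: no edge leaves it, so the second condition is vacuous. *)
exists [set z | connect e a z]; first by rewrite inE.
split.
  rewrite disjoint_subset; apply/subsetP => z; rewrite !inE => az.
  apply/imsetP => -[t]; rewrite inE => at_ zE.
  case/negP: Nc; apply: connect_trans az _; rewrite csym zE.
  case/connectP: at_ => p ap ->; apply/connectP; exists (map g p).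
    by rewrite path_map; apply: sub_path ap => s r; rewrite /= g_adj.
  by rewrite last_map.
move=> z + w; rewrite !inE => az /negP wN zw.
by case: wN; apply: connect_trans az (connect1 zw).
Qed.

Definition swap_fun (A : {set V}) (z : V) : V :=
  if z \in A then g z else if z \in g @: A then (g^-1)%g z else z.

Lemma swap_funK A : swappable A -> involutive (swap_fun A).
Proof.
case=> disj _ z; rewrite {2}/swap_fun; case: ifPn => [zA|zNA].
  have gzA : g z \in g @: A by apply: imset_f.
  by rewrite /swap_fun gzA (disjointFl disj gzA) permK.
case: ifPn => [/imsetP[t tA ->]|zNgA].
  by rewrite permK /swap_fun tA.
by rewrite /swap_fun (negPf zNA) (negPf zNgA).
Qed.

Lemma swap_fun_adj A : swappable A ->
  forall z w, e (swap_fun A z) (swap_fun A w) = e z w.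
Proof.
move=> swA; have inv := swap_funK swA.
(* For an involution, preserving edges in one direction is enough. *)
suff homo z w : e z w -> e (swap_fun A z) (swap_fun A w).
  move=> z w; apply/idP/idP; last exact: homo.
  by move=> /homo; rewrite !inv.
case: swA => disj bd.
have key s t : s \in A -> t \notin A -> e s t -> e (swap_fun A s) (swap_fun A t).
  move=> sA tNA st; rewrite {1}/swap_fun sA.
  case: (bd s sA t tNA st) => [gt|[tE gt]].
    rewrite /swap_fun (negPf tNA) ifN; first by rewrite -[X in e _ X]gt g_adj.
    by rewrite -gt (mem_imset _ _ perm_inj).
  rewrite /swap_fun (negPf tNA) tE imset_f // permK -tE e_sym //.
(* Pulled back by [g], such an edge leaves [A]; its outer end is then fixed by [g], as the
   alternative would put [t] in [A]. *)
have key' s t : s \in g @: A -> t \notin A -> t \notin g @: A -> e s t ->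
    e (swap_fun A s) (swap_fun A t).
  move=> sgA tNA tNgA st; have sNA := disjointFl disj sgA.
  rewrite /swap_fun sNA sgA (negPf tNA) (negPf tNgA).
  case/imsetP: sgA st sNA => s0 s0A -> st sNA; rewrite permK.
  have t0N : (g^-1)%g t \notin A.
    by apply: contra tNgA => tA; apply/imsetP; exists ((g^-1)%g t); rewrite ?permKV.
  have st0 : e s0 ((g^-1)%g t) by rewrite -g_adj permKV.
  have := bd s0 s0A _ t0N st0; rewrite permKV => -[tE|[_ ts0]].
    by rewrite tE.
  by rewrite ts0 s0A in tNA.
move=> zw; case: (boolP (z \in A)) => zA; case: (boolP (w \in A)) => wA.
- by rewrite /swap_fun zA wA g_adj.
- exact: key.
- by rewrite e_sym; apply: key => //; rewrite e_sym.
case: (boolP (z \in g @: A)) => zgA; case: (boolP (w \in g @: A)) => wgA.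
- by rewrite /swap_fun (negPf zA) (negPf wA) zgA wgA -g_adj !permKV.
- exact: key'.
- by rewrite e_sym; apply: key' => //; rewrite e_sym.
by rewrite /swap_fun (negPf zA) (negPf wA) (negPf zgA) (negPf wgA).
Qed.

(** The last clause makes [s] preserve every [g]-stable set, so that the exchange restricts to an
    induced subgraph. *)
Lemma perm_swap a : exists s : V -> V,
  [/\ involutive s, forall x y, e (s x) (s y) = e x y, s a = g a
    & forall x, s x \in [:: x; g x; (g^-1)%g x]].
Proof.
have [gaa|gaa] := eqVneq (g a) a.
  by exists id; split=> // x; rewrite inE eqxx.
have [A aA swA] := swappable_exists gaa.
exists (swap_fun A); split; first exact: swap_funK; first exact: swap_fun_adj.
  by rewrite /swap_fun aA.
by move=> x; rewrite /swap_fun !inE; do 2?[case: ifP => _]; rewrite eqxx ?orbT.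
Qed.

End Automorphism.
End ForestSwap.

(** * Isomorphisms between induced subgraphs *)

(* f and g matter only on A and B, where they are inverse to each other. *)
Record iso_on (G H : sgraph) (A : {set G}) (B : {set H})
    (f : G -> H) (g : H -> G) : Prop := IsoOn {
  iso_on_to : {in A, forall x, f x \in B};
  iso_on_from : {in B, forall y, g y \in A};
  iso_onK : {in A, cancel f g};
  iso_onKV : {in B, cancel g f};
  iso_on_adj : {in A &, forall x y, adj (f x) (f y) = adj x y}
}.

Lemma iso_on_id (G : sgraph) (A : {set G}) : iso_on A A id id.
Proof. by split. Qed.

Lemma iso_on_sym (G H : sgraph) (A : {set G}) (B : {set H}) f g :
  iso_on A B f g -> iso_on B A g f.
Proof.
case=> fB gA fK gK fadj; split=> // x y xB yB.
by rewrite -fadj ?gA // !gK.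
Qed.

Lemma iso_on_comp (G H K : sgraph) (A : {set G}) (B : {set H}) (C : {set K})
    f g f' g' :
  iso_on A B f g -> iso_on B C f' g' -> iso_on A C (f' \o f) (g \o g').
Proof.
case=> fB gA fK gK fadj [fB' gA' fK' gK' fadj']; split=> /=.
- by move=> x xA; rewrite fB' ?fB.
- by move=> y yC; rewrite gA ?gA'.
- by move=> x xA /=; rewrite fK' ?fB // fK.
- by move=> y yC /=; rewrite gK ?gA' // gK'.
- by move=> x y xA yA; rewrite fadj' ?fB // fadj.
Qed.

Section IsoOn.
Variables (G H : sgraph) (A : {set G}) (B : {set H}) (f : G -> H) (g : H -> G).
Hypothesis fg : iso_on A B f g.

Lemma iso_on_inj : {in A &, injective f}.
Proof. exact: can_in_inj (iso_onK fg). Qed.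

Lemma mem_iso_on (C : {set G}) x : C \subset A -> x \in A ->
  (f x \in f @: C) = (x \in C).
Proof.
move=> /subsetP CA xA; apply/imsetP/idP => [[y yC]|xC]; last by exists x.
by move/iso_on_inj => -> //; apply: CA.
Qed.

Lemma iso_on_imset : f @: A = B.
Proof.
case: fg => fB gA fK gK _; apply/setP => y; apply/imsetP/idP.
  by case=> x xA ->; apply: fB.
by move=> yB; exists (g y); rewrite ?gA ?gK.
Qed.

Lemma card_iso_on : #|A| = #|B|.
Proof. by rewrite -iso_on_imset (card_in_imset iso_on_inj). Qed.

Lemma iso_on_setD (C : {set G}) : C \subset A ->
  iso_on (A :\: C) (B :\: f @: C) f g.
Proof.
case: (fg) => fB gA fK gK fadj CA; split.
- by move=> x /setDP[xA xC]; rewrite inE mem_iso_on // xC fB.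
- move=> y /setDP[yB yC]; rewrite inE gA // andbT.
  by apply: contra yC => gyC; rewrite -(gK y yB) imset_f.
- by move=> x /setDP[xA _]; apply: fK.
- by move=> y /setDP[yB _]; apply: gK.
- by move=> x y /setDP[xA _] /setDP[yA _]; apply: fadj.
Qed.

Lemma iso_on_glue (C : {set G}) (D : {set H}) f' g' :
    iso_on C D f' g' -> [disjoint A & C] -> [disjoint B & D] ->
    {in A & C, forall x y, adj (f x) (f' y) = adj x y} ->
  exists F F', [/\ iso_on (A :|: C) (B :|: D) F F', {in A, F =1 f}
                 & {in C, F =1 f'}].
Proof.
case: (fg) => fB gA fK gK fadj [fB' gA' fK' gK' fadj'] dAC dBD cross.
exists (fun x => if x \in A then f x else f' x).
exists (fun y => if y \in B then g y else g' y).
have inC x : x \in C -> (x \in A) = false by move/(disjointFl dAC).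
have inD y : y \in D -> (y \in B) = false by move/(disjointFl dBD).
split; [split|by move=> x -> |by move=> x /inC ->].
- by move=> x /setUP[xA|xC]; rewrite inE ?xA ?(inC x xC) ?fB ?fB' ?orbT.
- by move=> y /setUP[yB|yD]; rewrite inE ?yB ?(inD y yD) ?gA ?gA' ?orbT.
- by move=> x /setUP[xA|xC]; rewrite ?xA ?(inC x xC) ?fB ?(inD _ (fB' _ xC)) ?fK ?fK'.
- by move=> y /setUP[yB|yD]; rewrite ?yB ?(inD y yD) ?gA ?(inC _ (gA' _ yD)) ?gK ?gK'.
- move=> x y /setUP[xA|xC] /setUP[yA|yC];
    rewrite ?xA ?yA ?(inC _ xC) ?(inC _ yC) ?fadj ?fadj' ?cross //.
  by rewrite adj_sym cross // adj_sym.
Qed.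

End IsoOn.

Lemma star_iso_on (G H : sgraph) (v : G) (L : {set G}) (v' : H) (L' : {set H}) :
    v \notin L -> v' \notin L' -> #|L| = #|L'| ->
    {in L, forall x, adj v x} -> {in L &, forall x y, adj x y = false} ->
    {in L', forall x, adj v' x} -> {in L' &, forall x y, adj x y = false} ->
  exists f g, iso_on (v |: L) (v' |: L') f g /\ f v = v'.
Proof.
move=> vL vL' cardL adjv adjL adjv' adjL'.
(* Leaves are matched by rank in the two enumerations; as the leaf sets have equal size, the default
   of [nth] is never reached on a leaf. *)
pose f x := if x == v then v' else nth v' (enum L') (index x (enum L)).
pose g y := if y == v' then v else nth v (enum L) (index y (enum L')).
have fv : f v = v' by rewrite /f eqxx.
have gv : g v' = v by rewrite /g eqxx.
have eL x : x \in L -> index x (enum L) < #|L'|.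
  by rewrite -cardL cardE index_mem mem_enum.
have eL' x : x \in L' -> index x (enum L') < #|L|.
  by rewrite cardL cardE index_mem mem_enum.
have neL x : x \in L -> (x == v) = false by move=> xL; apply: contraNF vL => /eqP <-.
have neL' x : x \in L' -> (x == v') = false by move=> xL; apply: contraNF vL' => /eqP <-.
have fL x : x \in L -> f x \in L'.
  by move=> xL; rewrite /f neL // -mem_enum mem_nth // -cardE eL.
have gL x : x \in L' -> g x \in L.
  by move=> xL; rewrite /g neL' // -mem_enum mem_nth // -cardE eL'.
exists f, g; split=> //; split.
- by move=> x /setU1P[->|xL]; rewrite ?fv ?setU11 // setU1r ?fL.
- by move=> x /setU1P[->|xL]; rewrite ?gv ?setU11 // setU1r ?gL.
- move=> x /setU1P[->|xL]; rewrite ?fv //.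
  rewrite /g neL' ?fL // /f neL // index_uniq ?enum_uniq -?cardE ?eL //.
  by rewrite nth_index // mem_enum.
- move=> x /setU1P[->|xL]; rewrite ?gv //.
  rewrite /f neL ?gL // /g neL' // index_uniq ?enum_uniq -?cardE ?eL' //.
  by rewrite nth_index // mem_enum.
- move=> x y /setU1P[->|xL] /setU1P[->|yL]; rewrite ?fv ?adj_irr //.
  + by rewrite adjv ?adjv' ?fL.
  + by rewrite adj_sym [RHS]adj_sym adjv ?adjv' ?fL.
  + by rewrite adjL ?adjL' ?fL.
Qed.

(** * Brushes *)

Definition nbrs (G : sgraph) (X : {set G}) (x : G) : {set G} :=
  [set y in X | adj x y].

Definition brush_at (G : sgraph) (X : {set G}) (v w : G) : {set G} :=
  v |: (nbrs X v :\ w).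

(* In the induced subgraph on X, v is the root of a brush, and w is the one
   neighbour of v outside it; w may be a leaf too, when the component is a star. *)
Definition brush_in (G : sgraph) (X : {set G}) (v w : G) : Prop :=
  [/\ v \in X, w \in nbrs X v
    & {in nbrs X v :\ w, forall x, nbrs X x = [set v]}].

Lemma nbrsD (G : sgraph) (X C : {set G}) x : nbrs (X :\: C) x = nbrs X x :\: C.
Proof. by apply/setP => y; rewrite !inE andbA. Qed.

Lemma iso_on_nbrs (G H : sgraph) (A : {set G}) (B : {set H}) f g x :
  iso_on A B f g -> x \in A -> nbrs B (f x) = f @: nbrs A x.
Proof.
move=> fg xA; apply/setP => y; rewrite inE; apply/andP/imsetP.
  case=> yB; rewrite -(iso_onKV fg yB) => fxy.
  have gyA := iso_on_from fg yB; exists (g y) => //.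
  by rewrite inE gyA -(iso_on_adj fg).
case=> z; rewrite inE => /andP[zA xz] ->.
by rewrite (iso_on_to fg) // (iso_on_adj fg).
Qed.

Section Brush.
Variables (G : sgraph) (X : {set G}) (v w : G).
Hypothesis br : brush_in X v w.
Local Notation L := (nbrs X v :\ w).
Local Notation B := (brush_at X v w).

Lemma brush_leafE x y : x \in L -> y \in X -> adj x y = (y == v).
Proof.
case: br => _ _ leaf /leaf/setP/(_ y); rewrite !inE => E yX.
by rewrite yX in E.
Qed.

Lemma brush_leaf_adj x : x \in L -> adj v x.
Proof. by rewrite !inE => /and3P[]. Qed.

Lemma brush_leaf_sub x : x \in L -> x \in X.
Proof. by rewrite !inE => /and3P[]. Qed.

Lemma brush_root_notin : v \notin L.
Proof. by rewrite !inE adj_irr !andbF. Qed.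

Lemma brush_leaf_indep : {in L &, forall x y, adj x y = false}.
Proof.
move=> x y xL yL; rewrite (brush_leafE xL) ?(brush_leaf_sub yL) //.
by apply: contraTF yL => /eqP ->; apply: brush_root_notin.
Qed.

Lemma brush_sub : B \subset X.
Proof.
case: br => vX _ _; apply/subsetP => x /setU1P[->//|]; exact: brush_leaf_sub.
Qed.

Lemma brush_anchor_notin : w \notin B.
Proof.
case: br => _ + _; rewrite !inE eqxx /= orbF => /andP[_].
by apply: contraTneq => ->; rewrite adj_irr.
Qed.

Lemma brush_anchor_in : w \in X :\: B.
Proof. by rewrite inE brush_anchor_notin; case: br => _ /setIdP[]. Qed.

(** Leaves see only the root, and the root sees only [w] outside; gluing along a brush thus has a
    single edge to match. *)
Lemma brush_crossE : {in X :\: B & B, forall x y, adj x y = (x == w) && (y == v)}.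
Proof.
move=> x y /setDP[xX]; rewrite in_setU1 negb_or => /andP[xv xL] /setU1P[->|yL].
  rewrite eqxx andbT; apply/idP/eqP => [xv'|->].
    apply/eqP; apply: contraNT xL => xw.
    by rewrite !inE xw xX adj_sym.
  by case: br => _ /setIdP[_]; rewrite adj_sym.
rewrite adj_sym (brush_leafE yL) // (negPf xv); symmetry; apply/negbTE.
rewrite negb_and; apply/orP; right.
by apply: contraTneq yL => ->; apply: brush_root_notin.
Qed.

Lemma card_brush : #|B| = #|L|.+1.
Proof. by rewrite cardsU1 brush_root_notin. Qed.

(** All neighbours of brush vertices lie in the brush or equal [w], and [C] misses them. *)
Lemma brush_setD (C : {set G}) : [disjoint C & B] -> w \notin C ->
  brush_in (X :\: C) v w /\ brush_at (X :\: C) v w = B.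
Proof.
move=> dCB wC; case: (br) => vX wX leaf.
have vC : v \notin C by rewrite (disjointFl dCB) // setU11.
have nE : nbrs (X :\: C) v = nbrs X v.
  rewrite nbrsD; apply/setDidPl; rewrite disjoint_sym disjoint_subset.
  apply/subsetP => x xC; rewrite inE; apply: contraNN wC => xn.
  have [<-//|xw] := eqVneq x w.
  by have := disjointFr dCB xC; rewrite in_setU1 in_setD1 xw xn orbT.
split; last by rewrite /brush_at nE.
split; rewrite ?nE //; first by rewrite inE vC.
move=> x /leaf xE; rewrite nbrsD xE; apply/setDidPl.
by rewrite disjoints1.
Qed.

End Brush.

Lemma iso_on_brush (G H : sgraph) (X : {set G}) (Y : {set H}) f g v w :
    iso_on X Y f g -> brush_in X v w ->
  brush_in Y (f v) (f w) /\ brush_at Y (f v) (f w) = f @: brush_at X v w.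
Proof.
move=> fg br; case: (br) => vX wN leaf.
have wX : w \in X by case/setIdP: wN.
have LE : nbrs Y (f v) :\ f w = f @: (nbrs X v :\ w).
  rewrite (iso_on_nbrs fg vX); apply/setP => y; rewrite in_setD1.
  apply/andP/imsetP => [[yw /imsetP[x xN yE]]|[x /setD1P[xw xN] ->]].
    exists x => //; rewrite in_setD1 xN andbT.
    by apply: contraNneq yw; rewrite yE => ->.
  have xX : x \in X by case/setIdP: xN.
  split; last exact: imset_f.
  by apply: contraNneq xw => /(iso_on_inj fg xX wX) ->.
split; last by rewrite /brush_at LE imsetU1.
split; first exact: iso_on_to fg _ vX.
  by rewrite (iso_on_nbrs fg vX) imset_f.
rewrite LE => _ /imsetP[x xL ->].
by rewrite (iso_on_nbrs fg) ?(brush_leaf_sub xL) // leaf // imset_set1.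
Qed.

Lemma setD_setU (T : finType) (A B : {set T}) : B \subset A -> A :\: B :|: B = A.
Proof.
by move/setIidPr=> BA; rewrite -{2}(setID A B) BA setUC.
Qed.

Lemma brush_iso_on (G H : sgraph) (X : {set G}) (Y : {set H}) v w v' w' :
    brush_in X v w -> brush_in Y v' w' ->
    #|brush_at X v w| = #|brush_at Y v' w'| ->
  exists f g, iso_on (brush_at X v w) (brush_at Y v' w') f g /\ f v = v'.
Proof.
move=> b b'; rewrite !card_brush => -[cL]; apply: star_iso_on => //.
- exact: brush_root_notin.
- exact: brush_root_notin.
- exact: brush_leaf_adj.
- exact: brush_leaf_indep.
- exact: brush_leaf_adj.
- exact: brush_leaf_indep.
Qed.

(** The condition [f w = w'] takes care of the one crossing edge. Agreement with [f] off the brush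
    later locates the image of a second anchor. *)
Lemma brush_glue (G H : sgraph) (X : {set G}) (Y : {set H}) v w v' w' f g :
    brush_in X v w -> brush_in Y v' w' ->
    #|brush_at X v w| = #|brush_at Y v' w'| ->
    iso_on (X :\: brush_at X v w) (Y :\: brush_at Y v' w') f g -> f w = w' ->
  exists F F', iso_on X Y F F' /\ {in X :\: brush_at X v w, F =1 f}.
Proof.
move=> b b' cB fg fw; have [h [h' [hh hv]]] := brush_iso_on b b' cB.
have [|||F [F' [FF Ff _]]] := iso_on_glue fg hh.
- by rewrite disjoints_subset setDE subsetIr.
- by rewrite disjoints_subset setDE subsetIr.
- move=> x y xX yB; rewrite (brush_crossE b) // (brush_crossE b').
  + rewrite -fw -hv (inj_in_eq (iso_on_inj fg)) ?(brush_anchor_in b) //.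
    by rewrite (inj_in_eq (iso_on_inj hh)) // setU11.
  + exact: iso_on_to fg x xX.
  + exact: iso_on_to hh y yB.
exists F, F'; split=> //; move: FF.
by rewrite !setD_setU // ?(brush_sub b) ?(brush_sub b').
Qed.

(** This transfers [perm_swap] from permutations of a whole vertex type to automorphisms of an
    induced subgraph. *)
Lemma iso_on_swap (G : sgraph) (M : {set G}) h h' a :
    acyclic G -> iso_on M M h h' -> a \in M ->
  exists s, [/\ iso_on M M s s, s a = h a & s (h a) = a].
Proof.
(* Vertices outside [M] are kept but isolated, so [e] is still a forest and [h], extended by the
   identity, an automorphism of it. *)
move=> acG hh aM; pose e := [rel x y | [&& x \in M, y \in M & adj x y]].
have e_sym : symmetric e by move=> x y; rewrite /= adj_sym andbCA.
have e_ac c : ucycle e c -> size c <= 2.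
  case/andP=> ce uc; apply: acG; rewrite /ucycle uc andbT.
  by apply: sub_cycle ce => x y /and3P[].
pose p x := if x \in M then h x else x.
have pM x : (p x \in M) = (x \in M).
  by rewrite /p; case: ifP => // xM; rewrite (iso_on_to hh).
have p_inj : injective p.
  move=> x y pxy; have xyM : (x \in M) = (y \in M) by rewrite -(pM x) -(pM y) pxy.
  move: pxy; rewrite /p xyM; case: ifP => // yM.
  by apply: (iso_on_inj hh); rewrite ?xyM.
have g_adj x y : e (perm p_inj x) (perm p_inj y) = e x y.
  rewrite /= !permE !pM; case: (boolP (x \in M)) => //= xM.
  case: (boolP (y \in M)) => //= yM.
  by rewrite /p xM yM (iso_on_adj hh).
have [s [sK s_adj sa sin]] := perm_swap e_sym e_ac g_adj a.
have {}sa : s a = h a by rewrite sa permE /p aM.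
have sM x : x \in M -> s x \in M.
  move=> xM; have := sin x; rewrite !inE => /or3P[] /eqP -> //.
    by rewrite permE pM.
  by rewrite -(pM (_ x)) -(permE p_inj) permKV.
exists s; split=> //; last by rewrite -sa sK.
split; [exact: sM|exact: sM|by move=> x _; apply: sK|by move=> x _; apply: sK|].
move=> x y xM yM.
by have := s_adj x y; rewrite /= xM yM !sM.
Qed.

(** * Cancelling brushes of equal size *)

Section TwoBrushes.
Variables (G : sgraph) (X : {set G}) (v1 w1 v2 w2 : G).
Hypotheses (b1 : brush_in X v1 w1) (b2 : brush_in X v2 w2).
Hypothesis cB : #|brush_at X v1 w1| = #|brush_at X v2 w2|.

(** A root that is a leaf of the other brush has [v2] as its only neighbour, so its own brush has no
    leaves, against the equality of sizes. *)
Lemma brush_root_notin_leaves : v1 \notin nbrs X v2 :\ w2.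
Proof.
apply/negP => v1L; case: (b2) => _ _ /(_ v1 v1L) NE.
have L1 : nbrs X v1 :\ w1 = set0.
  case: (b1) => _; rewrite NE inE => /eqP -> _; exact: setDv.
move: cB; rewrite !card_brush L1 cards0 => -[/esym/cards0_eq/setP/(_ v1)].
by rewrite v1L inE.
Qed.

End TwoBrushes.

Lemma brush_disjoint (G : sgraph) (X : {set G}) v1 w1 v2 w2 :
    brush_in X v1 w1 -> brush_in X v2 w2 ->
    #|brush_at X v1 w1| = #|brush_at X v2 w2| -> v1 != v2 ->
  [disjoint brush_at X v1 w1 & brush_at X v2 w2].
Proof.
move=> b1 b2 cB v12; rewrite disjoint_subset; apply/subsetP => z zB1.
rewrite inE; apply/negP => zB2.
case/setU1P: zB1 zB2 => [->|zL1] /setU1P[].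
- by apply/eqP.
- by apply/negP; apply: brush_root_notin_leaves b1 b2 cB.
- by move=> zE; move: zL1; rewrite zE; apply/negP;
     apply: brush_root_notin_leaves b2 b1 _.
move=> zL2; case: b1 b2 => _ _ /(_ z zL1) zE [_ _ /(_ z zL2)].
rewrite zE => /set1_inj vE.
by rewrite vE eqxx in v12.
Qed.

(** The given [f] says nothing about anchors; it is traded for an isomorphism that matches them, by
    strong induction on [#|X|] inside a fixed [G]. *)
Lemma brush_cancel (G : sgraph) (X : {set G}) v1 w1 v2 w2 f g :
    acyclic G -> brush_in X v1 w1 -> brush_in X v2 w2 ->
    iso_on (X :\: brush_at X v1 w1) (X :\: brush_at X v2 w2) f g ->
  exists F F',
    iso_on (X :\: brush_at X v1 w1) (X :\: brush_at X v2 w2) F F' /\ F w1 = w2.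
Proof.
move=> acG; have [n] := ubnP #|X|.
elim: n X v1 w1 v2 w2 f g => // n IH X v1 w1 v2 w2 f g ltXn b1 b2 fg.
set B1 := brush_at X v1 w1 in fg *; set B2 := brush_at X v2 w2 in fg *.
have B1X : B1 \subset X by apply: brush_sub.
have B2X : B2 \subset X by apply: brush_sub.
have cB : #|B1| = #|B2|.
  have := card_iso_on fg; rewrite !cardsD (setIidPr B1X) (setIidPr B2X).
  have := subset_leq_card B1X; have := subset_leq_card B2X; lia.
have [vE|v12] := eqVneq v1 v2.
  have [wE|w12] := eqVneq w1 w2.
    by exists id, id; rewrite /B1 /B2 vE wE; split=> //; apply: iso_on_id.
  (* Each anchor is a leaf of the other brush: the component of [v1] is a star, and removing either
     brush leaves [C] and one isolated anchor. *)
  subst v2; pose C := X :\: (v1 |: nbrs X v1).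
  have w1N : w1 \in nbrs X v1 by case: b1.
  have w2N : w2 \in nbrs X v1 by case: b2.
  have w1L : w1 \in nbrs X v1 :\ w2 by rewrite in_setD1 w12.
  have w2L : w2 \in nbrs X v1 :\ w1 by rewrite in_setD1 eq_sym w12.
  have XBE w : w \in nbrs X v1 -> X :\: brush_at X v1 w = C :|: (w |: set0).
    move=> wN; have [wX v1w] := setIdP wN.
    apply/setP => x; rewrite !inE; have [->|xw] /= := eqVneq x w.
      rewrite wX orbT /= andbT orbF; apply: contraTneq v1w => ->.
      by rewrite adj_irr.
    by rewrite !orbF.
  have dC w : w \in nbrs X v1 -> [disjoint C & w |: set0].
    by move=> wN; rewrite setU0 disjoint_sym disjoints1 in_setD in_setU1 wN orbT.
  (* Stars without leaves: this is the one-point isomorphism from [w1] to [w2]. *)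
  have [||||||h [h' [hh hw]]] := @star_iso_on G G w1 set0 w2 set0 _ _ (erefl _);
    try by [rewrite inE | move=> x; rewrite inE | move=> x y; rewrite inE].
  have [|||F [F' [FF _ Fw]]] := iso_on_glue (iso_on_id C) hh.
  - exact: dC.
  - exact: dC.
  - move=> x y /setDP[xX xN]; rewrite setU0 => /set1P ->; rewrite hw.
    rewrite ![adj x _]adj_sym (brush_leafE b1 w2L) // (brush_leafE b2 w1L) //.
  exists F, F'; rewrite /B1 /B2 !XBE //; split=> //.
  by rewrite Fw // setU0 inE.
have dB : [disjoint B1 & B2] by apply: brush_disjoint.
have X1E : X :\: B1 = X :\: B1 :\: B2 :|: B2.
  by rewrite setD_setU // subsetD B2X disjoint_sym.
have X2E : X :\: B2 = X :\: B1 :\: B2 :|: B1.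
  by rewrite setDDl [B1 :|: B2]setUC -setDDl setD_setU // subsetD B1X.
(* If the roots are adjacent, the two brushes form a whole component: keep the rest fixed and map
   [B2] onto [B1]. *)
have [w1v2|w1v2] := eqVneq w1 v2.
  have w2v1 : w2 = v1.
    apply/eqP; apply: contraTT dB => w2v1; apply/pred0Pn; exists v1 => /=.
    rewrite setU11 !inE [v1 == w2]eq_sym w2v1; case: b1 => -> /setIdP[_].
    by rewrite w1v2 adj_sym => ->; rewrite orbT.
  have [h [h' [hh hv]]] := brush_iso_on b2 b1 (esym cB).
  have [|||F [F' [FF _ Fw]]] := iso_on_glue (iso_on_id (X :\: B1 :\: B2)) hh.
  - by rewrite disjoints_subset setDE subsetIr.
  - by rewrite setDDl setUC -setDDl disjoints_subset setDE subsetIr.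
  - move=> x y /setDP[/setDP[xX xB1] xB2] yB2.
    have xX1 : x \in X :\: B1 by rewrite inE xB1.
    have xX2 : x \in X :\: B2 by rewrite inE xB2.
    rewrite /= [adj x y](brush_crossE b2) // (brush_crossE b1) //; last first.
      exact: iso_on_to hh y yB2.
    have -> : (x == w1) = false.
      by apply: contraNF xB2 => /eqP ->; rewrite w1v2 setU11.
    suff -> : (x == w2) = false by [].
    by apply: contraNF xB1 => /eqP ->; rewrite w2v1 setU11.
  exists F, F'; rewrite X1E X2E; split=> //.
  by rewrite w1v2 Fw ?setU11 // hv w2v1.
have w2v1 : w2 != v1.
  apply: contraTneq dB => w2v1; apply/pred0Pn; exists v2 => /=.
  rewrite [v2 \in B2]setU11 andbT !inE [v2 == w1]eq_sym w1v2.
  by case: b2 => -> /setIdP[_]; rewrite w2v1 adj_sym => ->; rewrite orbT.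
(* As a leaf of [B2], [w1] would have [v2] as its only neighbour, but it is adjacent to [v1]. *)
have w1B2 : w1 \notin B2.
  rewrite in_setU1 negb_or w1v2; apply/negP => w1L.
  case: b1 => v1X /setIdP[_]; rewrite adj_sym (brush_leafE b2 w1L) // => /eqP v1E.
  by rewrite v1E eqxx in v12.
have w2B1 : w2 \notin B1.
  rewrite in_setU1 negb_or w2v1; apply/negP => w2L.
  case: b2 => v2X /setIdP[_]; rewrite adj_sym (brush_leafE b1 w2L) // => /eqP v2E.
  by rewrite v2E eqxx in v12.
have [b2' B2E] := brush_setD b2 dB w2B1.
have dB' : [disjoint B2 & B1] by rewrite disjoint_sym.
have [b1' B1E] := brush_setD b1 dB' w1B2.
have gf := iso_on_sym fg.
have [b1g B1gE] := iso_on_brush gf b1'.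
have ltX1 : #|X :\: B1| < n.
  have := card_brush X v1 w1; have := subset_leq_card B1X.
  rewrite [#|X :\: B1|]cardsD (setIidPr B1X) -/B1; lia.
have B1X2 : B1 \subset X :\: B2 by rewrite subsetD B1X.
have gfD := iso_on_setD gf B1X2.
have ME : X :\: B2 :\: B1 = X :\: B1 :\: B2 by rewrite !setDDl setUC.
(* In [X :\: B1] the two brushes are now [B2] and the image of [B1] under [g]; restricting [g] gives
   the isomorphism between their complements. *)
have [|F [F' [FF Fw]]] := IH _ _ _ _ _ g f ltX1 b2' b1g.
  by rewrite B2E B1gE B1E -ME.
rewrite B2E B1gE B1E in FF.
(* Following [F] by [f] gives an automorphism of the common remainder that sends [w2] to
   [f (g w1) = w1]. *)
have hM := iso_on_comp FF (iso_on_sym gfD); rewrite ME in hM.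
have w2M : w2 \in X :\: B1 :\: B2.
  by rewrite !in_setD w2B1 (brush_anchor_notin b2); case: b2 => _ /setIdP[].
have w1M : w1 \in X :\: B1 :\: B2.
  by rewrite !in_setD w1B2 (brush_anchor_notin b1); case: b1 => _ /setIdP[].
have w1X2 : w1 \in X :\: B2 by rewrite inE w1B2; case: b1 => _ /setIdP[].
have [s [ss sw2 sw1]] := iso_on_swap acG hM w2M.
have hw2 : (f \o F) w2 = w1 by rewrite /= Fw (iso_onKV fg).
rewrite hw2 in sw2 sw1.
(* Both halves of the exchange count: [s w2 = w1] allows the gluing, and [s w1 = w2] yields the
   required value at [w1]. *)
have [||H [H' [HH Hs]]] := @brush_glue _ _ _ _ _ _ _ _ s s b2' b1' _ _ sw2.
- by rewrite B2E B1E.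
- by rewrite B2E B1E ME.
exists H, H'; split=> //.
by rewrite Hs ?B2E.
Qed.

(** Even the last leaf may go: [brush_in] admits a bare root with its anchor. *)
Lemma brush_delete_leaf (G : sgraph) (X : {set G}) u v w :
    brush_in X v w -> u \in nbrs X v :\ w ->
  brush_in (X :\ u) v w /\ brush_at (X :\ u) v w = brush_at X v w :\ u.
Proof.
move=> b uL; case: (b) => vX wN leaf.
have uv : v != u by apply: contraTneq uL => <-; apply: brush_root_notin.
have uw : w != u by case/setD1P: uL; rewrite eq_sym.
have LE : nbrs (X :\ u) v :\ w = (nbrs X v :\ w) :\ u.
  by rewrite nbrsD !setDDl setUC.
split; last first.
  by rewrite /brush_at LE setDUl [[set v] :\ u](_ : _ = [set v]) //;
     apply/setDidPl; rewrite disjoints1 inE.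
split; first by rewrite in_setD1 uv.
  by rewrite nbrsD in_setD1 uw.
move=> x; rewrite LE => /setD1P[_ /leaf xE]; rewrite nbrsD xE.
by apply/setDidPl; rewrite disjoints1 inE.
Qed.

(** * Restating the hypotheses of the theorem for induced subgraphs *)

Lemma delete_iso_on (G H : sgraph) (u : G) (u' : H) :
    isomorphic (delete_vertex u) (delete_vertex u') ->
  exists f g, iso_on [set~ u] [set~ u'] f g.
Proof.
case=> h [[k hK kK] h_adj].
(* The value at the deleted vertex is arbitrary, since [iso_on] looks only at its complement. *)
pose f x : H := if insub x is Some s then val (h s) else u'.
pose g y : G := if insub y is Some s then val (k s) else u.
have fE (s : delete_vertex u) : f (val s) = val (h s) by rewrite /f valK.
have gE (s : delete_vertex u') : g (val s) = val (k s) by rewrite /g valK.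
have inG x : x \in [set~ u] -> exists s : delete_vertex u, x = val s.
  by rewrite !inE => xu; exists (Sub x xu); rewrite SubK.
have inH x : x \in [set~ u'] -> exists s : delete_vertex u', x = val s.
  by rewrite !inE => xu; exists (Sub x xu); rewrite SubK.
exists f, g; split.
- by move=> x /inG[s ->]; rewrite fE !inE (valP (h s)).
- by move=> x /inH[s ->]; rewrite gE !inE (valP (k s)).
- by move=> x /inG[s ->]; rewrite fE gE hK.
- by move=> x /inH[s ->]; rewrite gE fE kK.
- by move=> x y /inG[s ->] /inG[t ->]; rewrite !fE; apply: (h_adj s t).
Qed.

Lemma iso_on_isomorphic (G H : sgraph) f g :
  iso_on [set: G] [set: H] f g -> isomorphic G H.
Proof.
case=> _ _ fK gK f_adj; exists f; split.
  by exists g => x; [apply: fK | apply: gK]; rewrite inE.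
by move=> x y; apply: f_adj; rewrite inE.
Qed.

(** At most [k] neighbours of [v] lie in the brush and its degree is at least [k + 1], so exactly
    one lies outside: this is [w]. *)
Lemma end_of_brushP (G : sgraph) (u v : G) : end_of_brush_rooted_at u v ->
  exists w, brush_in [set: G] v w /\ u \in nbrs [set: G] v :\ w.
Proof.
case=> H [[[k [k0 [f [[fbij f_adj] fv fleaf kdeg out1]]]] _] uH du].
have [f' fK f'K] := fbij.
have inH x : x \in sg_verts H -> exists o, x = val (f o).
  by move=> xH; exists (f' (Sub x xH)); rewrite f'K SubK.
have leafH x : x \in sg_verts H -> x != v -> exists i, x = val (f (star_leaf i)).
  move=> /inH[[i|] ->]; first by exists i.
  by rewrite -fv eqxx.
have adjH i : adj v (val (f (star_leaf i))).
  have := f_adj (star_centre k) (star_leaf i); rewrite /= /gos_adj fv.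
  by move/sg_adj_sub/and3P=> [].
have Ncard : #|[set y | adj v y & y \in sg_verts H]| <= k.
  have sub : [set y | adj v y & y \in sg_verts H]
      \subset [set val (f (star_leaf i)) | i : 'I_k].
    apply/subsetP => y; rewrite inE => /andP[vy yH].
    have yv : y != v by apply: contraTneq vy => ->; rewrite adj_irr.
    by have [i ->] := leafH y yH yv; apply: imset_f.
  apply: leq_trans (subset_leq_card sub) _.
  by rewrite -[X in _ <= X]card_ord; apply: leq_imset_card.
have degE : degree v = #|[set y | adj v y & y \in sg_verts H]|
                      + #|[set y | adj v y & y \notin sg_verts H]|.
  rewrite /degree -(cardsID (sg_verts H)); congr (_ + _).
    by apply: eq_card => y; rewrite !inE.
  by apply: eq_card => y; rewrite !inE andbC.
have /card_gt0P[w] : 0 < #|[set y | adj v y & y \notin sg_verts H]| by lia.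
rewrite inE => /andP[vw wH]; exists w.
have leafE x : adj v x -> x != w -> x \in sg_verts H.
  move=> vx xw; apply: contraNT xw => xH; apply/eqP.
  by apply: (card_le1_eqP out1); rewrite inE ?vx ?vw.
split; last first.
  (* The root has degree at least [k + 1], hence at least 2 because [0 < k], whereas [u] has degree
     1. *)
  have uv : u != v by apply: contraTneq kdeg => <-; rewrite du; lia.
  have [i uE] := leafH u uH uv.
  have vu : adj v u by rewrite uE.
  rewrite !inE vu !andbT.
  by apply: contraNneq wH => <-.
split; rewrite ?inE //.
move=> x; rewrite !inE /= => /andP[xw vx].
have xv : x != v by apply: contraTneq vx => ->; rewrite adj_irr.
have [i xE] := leafH x (leafE x vx xw) xv.
have /eqP/cards1P[y yE] : degree x = 1 by rewrite xE.
have nE : nbrs setT x = [set y] by rewrite -yE; apply/setP => z; rewrite !inE.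
have : v \in nbrs setT x by rewrite !inE adj_sym.
by rewrite nE inE => /eqP ->.
Qed.

(** * What remains after deleting the root of a brush *)

Definition isolated_off (G : sgraph) (v : G) : {set G} :=
  [set x in [set~ v] | nbrs [set~ v] x == set0].

Section Core.
Variables (G : sgraph) (v w : G).
Hypotheses (conG : is_connected G) (b : brush_in [set: G] v w).

Lemma nbrs_setC1 x : nbrs [set~ v] x = nbrs [set: G] x :\ v.
Proof. by rewrite -nbrsD setTD. Qed.

(** If [w] has no neighbour but [v], then [v] and its neighbours are closed under adjacency, hence
    everything by connectedness. *)
Lemma isolated_off_all : nbrs [set~ v] w = set0 ->
  isolated_off v = [set~ v] /\ [set: G] :\: brush_at [set: G] v w = [set w].
Proof.
rewrite nbrs_setC1 => w0; case: (b) => _ wN leaf.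
have wv : w != v by case/setIdP: wN => _; apply: contraTneq => ->; rewrite adj_irr.
have N1 x : x \in nbrs [set: G] v -> nbrs [set: G] x :\ v = set0.
  move=> xN; have [->//|xw] := eqVneq x w.
  by rewrite leaf ?setDv // in_setD1 xw.
have all x : x \in v |: nbrs [set: G] v.
  suff /closed_connect cl : closed (@adj G) (v |: nbrs [set: G] v).
    by rewrite -(cl v x (conG.2 v x)) setU11.
  apply: intro_closed; first exact: (sym_connect_sym (@adj_sym G)).
  move=> y z yz /setU1P[yE|/N1/setP/(_ z)]; first by rewrite !inE -yE yz orbT.
  by rewrite !inE yz /= andbT => /negbFE ->.
split.
  apply/setP => x; rewrite inE nbrs_setC1; case: (boolP (x \in [set~ v])) => //=.
  rewrite !inE => xv; apply/eqP/N1; have := all x.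
  by rewrite in_setU1 (negPf xv).
apply/setP => x; rewrite in_setD in_setT andbT in_setU1 in_setD1 in_set1.
have := all x; rewrite in_setU1; have [->|xw] /= := eqVneq x w.
  by rewrite (negPf wv).
by move=> ->.
Qed.

(** The isolated vertices are exactly the leaves: the first edge of a path from such a vertex to [v]
    can only lead to [v]. *)
Lemma brush_isolated_off : nbrs [set~ v] w != set0 ->
  [set: G] :\: brush_at [set: G] v w = [set~ v] :\: isolated_off v.
Proof.
move=> w0; case: (b) => _ wN leaf.
suff -> : isolated_off v = nbrs [set: G] v :\ w by rewrite -setDDl setTD.
apply/setP => x; rewrite inE nbrs_setC1; apply/andP/idP => [[]|xL]; last first.
  rewrite leaf // setDv eqxx; split=> //; rewrite !inE.
  by apply: contraTneq xL => ->; apply: brush_root_notin.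
rewrite !inE => xv x0; apply/andP; split.
  by apply: contraNneq w0 => <-; rewrite nbrs_setC1.
have /connectP[[|y p] /=] := conG.2 x v; first by move=> _ vx; rewrite vx eqxx in xv.
case/andP=> xy _ _; move/eqP/setP/(_ y): x0; rewrite !inE xy /= andbT => /negbFE/eqP <-.
by rewrite adj_sym.
Qed.

End Core.

Lemma iso_on_isolated_off (G H : sgraph) (v : G) (v' : H) f g :
  iso_on [set~ v] [set~ v'] f g -> f @: isolated_off v = isolated_off v'.
Proof.
move=> fg; have gf := iso_on_sym fg.
apply/setP => y; apply/imsetP/idP => [[x /setIdP[xv /eqP x0] ->]|/setIdP[yv /eqP y0]].
  by rewrite inE (iso_on_to fg) // (iso_on_nbrs fg) // x0 imset0 eqxx.
exists (g y); last by rewrite (iso_onKV fg).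
by rewrite inE (iso_on_to gf) // (iso_on_nbrs gf) // y0 imset0 eqxx.
Qed.

(* Off its isolated vertices, G - v is what remains of G without the brush; the
   only exception is when the attaching vertex w is itself isolated in G - v,
   i.e. when G is a star. *)
Lemma core_iso_on (G H : sgraph) (v w : G) (v' w' : H) f g :
    is_connected G -> is_connected H ->
    brush_in [set: G] v w -> brush_in [set: H] v' w' ->
    iso_on [set~ v] [set~ v'] f g ->
  exists F F', iso_on ([set: G] :\: brush_at [set: G] v w)
                      ([set: H] :\: brush_at [set: H] v' w') F F'.
Proof.
move=> conG conH b b' fg; have IE := iso_on_isolated_off fg.
have wv : w \in [set~ v].
  rewrite !inE; case: b => _ /setIdP[_ + _]; apply: contraTneq => ->.
  by rewrite adj_irr.
have wv' : w' \in [set~ v'].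
  rewrite !inE; case: b' => _ /setIdP[_ + _]; apply: contraTneq => ->.
  by rewrite adj_irr.
have imv : isolated_off v \subset [set~ v] by apply/subsetP => x /setIdP[].
have [w0|w0] := eqVneq (nbrs [set~ v] w) set0;
have [w0'|w0'] := eqVneq (nbrs [set~ v'] w') set0.
- have [_ ->] := isolated_off_all conG b w0.
  have [_ ->] := isolated_off_all conH b' w0'.
  exists (fun=> w'), (fun=> w).
  by split=> [x _|x _|x /set1P ->|x /set1P ->|x y /set1P -> /set1P ->];
     rewrite ?inE ?adj_irr.
(* The mixed cases are impossible: on one side every vertex is isolated, on the other the anchor is
   not. *)
- have [I _] := isolated_off_all conG b w0.
  move: IE; rewrite I (iso_on_imset fg) => /setP/(_ w').
  by rewrite wv' inE wv' (negPf w0').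
- have [I' _] := isolated_off_all conH b' w0'.
  have : f w \in f @: isolated_off v by rewrite IE I' (iso_on_to fg).
  by rewrite (mem_iso_on fg) // inE wv (negPf w0).
rewrite (brush_isolated_off conG b w0) (brush_isolated_off conH b' w0') -IE.
by exists f, g; apply: iso_on_setD.
Qed.

Theorem theorem3 (T T' : sgraph) (hT : is_tree T) (hT' : is_tree T')
    (u v : T) (u' v' : T')
    (h1 : end_of_brush_rooted_at u v)
    (h2 : end_of_brush_rooted_at u' v')
    (h3u : isomorphic (delete_vertex u) (delete_vertex u'))
    (h3v : isomorphic (delete_vertex v) (delete_vertex v')) :
  isomorphic T T'.
Proof.
have [w [b uL]] := end_of_brushP h1; have [w' [b' uL']] := end_of_brushP h2.
have [p [q pq]] := delete_iso_on h3u; have [r [r' rr]] := delete_iso_on h3v.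
have [c [c' cc]] := core_iso_on hT.1 hT'.1 b b' rr.
have [bu BuE] := brush_delete_leaf b uL; have [bu' BuE'] := brush_delete_leaf b' uL'.
rewrite setTD in bu BuE; rewrite setTD in bu' BuE'.
set B := brush_at [set: T] v w in cc BuE *.
set B' := brush_at [set: T'] v' w' in cc BuE' *.
have uB : u \in B by rewrite setU1r.
have uB' : u' \in B' by rewrite setU1r.
have SE : [set~ u] :\: brush_at [set~ u] v w = [set: T] :\: B.
  by rewrite BuE; apply/setP => x; rewrite !in_setD !in_set1 !in_setT !andbT in_setC1;
     have [->|] := eqVneq x u; rewrite ?uB // andbT.
have SE' : [set~ u'] :\: brush_at [set~ u'] v' w' = [set: T'] :\: B'.
  by rewrite BuE'; apply/setP => x; rewrite !in_setD !in_set1 !in_setT !andbT in_setC1;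
     have [->|] := eqVneq x u'; rewrite ?uB' // andbT.
(* Transporting the second brush by [q] places both brushes in [T] minus [u], ready for
   cancellation. *)
have qp := iso_on_sym pq; have [bq BqE] := iso_on_brush qp bu'.
have qpD := iso_on_setD qp (brush_sub bu').
have fg := iso_on_comp cc; rewrite -SE -SE' in fg.
have [F [F' [FF Fw]]] : exists F F', iso_on ([set~ u] :\: brush_at [set~ u] v w)
    ([set~ u] :\: brush_at [set~ u] (q v') (q w')) F F' /\ F w = q w'.
  by apply: (brush_cancel hT.2 bu bq); rewrite BqE; apply: fg qpD.
rewrite BqE in FF.
(* Going back by [p] turns the matched anchors into an isomorphism of the cores that sends [w] to
   [w']. *)
have pF := iso_on_comp FF (iso_on_sym qpD); rewrite SE SE' in pF.
have pFw : (p \o F) w = w'.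
  by rewrite /= Fw (iso_onKV pq) //; case: bu' => _ /setIdP[].
(* The cores have equal size, and so do the trees minus one vertex; nonemptiness is needed for the
   truncated subtraction. *)
have cB : #|B| = #|B'|.
  have := card_iso_on cc; have := card_iso_on pq.
  have := max_card B; have := max_card B'; rewrite !cardsC1 !cardsD !setTI !cardsT.
  have : 0 < #|T| by apply/card_gt0P; exists u.
  have : 0 < #|T'| by apply/card_gt0P; exists u'.
  lia.
have [H [H' [HH _]]] := brush_glue b b' cB pF pFw.
exact: iso_on_isomorphic HH.
Qed.
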